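(* Let $G=(V,E)$ be a finite connected graph, $W\subset V$ a (possibly empty) set of vertices, and $w$ a non-negative weight function on oriented cycles of $G$ (possibly taking values larger than $1$). Let $C$ be a subset of $\mathcal C_+(G\setminus W)$ such that $\mu_w^W(\mathcal C_+(\mathsf F)=C)>0$, and let $A$ be the set of vertices which are extremities of edges in $C$. Let $\mathsf F$ be an ECRSF with respect to $W$ sampled according to $\mu_w^W$. Then, conditional on $\mathcal C_+(\mathsf F)=C$, the configuration $\mathsf F\setminus C$ (obtained by removing from $\mathsf F$ the edges of the cycles in $C$) has the same law as an ECRSF with respect to $A\cup W$ with weight function $w_-$, i.e. its law is $\mu_{w_-}^{A\cup W}$.
   Context: For a finite graph $G$ and $W\subset V$, an essential cycle-rooted spanning forest (ECRSF) with respect to $W$ is a spanning subgraph $F$ of $G$ (containing all vertices) each of whose connected components is either disjoint from $W$ and contains exactly one cycle, or is a tree containing exactly one vertex of $W$. $\mathcal U_W(G)$ denotes the set of ECRSFs with respect to $W$. For a subgraph $F$, $\mathcal C(F)$ is the set of unoriented simple cycles of $F$, and $\gamma,\gamma^{-1}$ are the two orientations of $[\gamma]\in\mathcal C(F)$. For a non-negative weight function $w$ on oriented cycles, $\mu_w^W$ is the probability measure on $\mathcal U_W(G)$ given by $$\mu_w^W(F)=\frac{1}{Z_w^W}\prod_{[\gamma]\in\mathcal C(F)}\bigl(w(\gamma)+w(\gamma^{-1})\bigr),$$ with $Z_w^W$ the normalizing constant (assumed positive). $\mathcal C_+(G\setminus W)$ is the set of (''positive'') cycles of $G$ avoiding $W$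 with weight strictly larger than $1$, and $\mathcal C_-(G\setminus W)$ the set of the other (''negative'') cycles of $G$ avoiding $W$. An unoriented cycle is regarded as positive if at least one of its two orientations has weight $>1$. $\mathcal C_+(F)$ is the set of positive cycles of $F$. The weight function $w_-$ is defined by $w_-=w$ on (both orientations of) cycles in $\mathcal C_-(G\setminus W)$ and $w_-=0$ on (both orientations of) cycles in $\mathcal C_+(G\setminus W)$. *)

(* Defs.v *)
From HB Require Import structures.
From mathcomp Require Import all_boot all_order all_algebra.

Set Implicit Arguments.
Unset Strict Implicit.
Unset Printing Implicit Defensive.

Import Order.TTheory GRing.Theory Num.Theory.
Local Open Scope ring_scope.

(* Finite graph; parallel edges and loops are allowed, a simple graph being the
   special case where [ends] lists each pair of adjacent vertices once. The
   order of the two components of [ends e] is only an arbitrary reference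
   orientation of the edge [e]. *)
Record graph := Graph {
  vertex : finType;
  edge : finType;
  ends : edge -> vertex * vertex }.

Section Graphs.
Variable G : graph.

(* An oriented edge: [(e, true)] is [e] with its reference orientation,
   [(e, false)] is [e] with the opposite one. *)
Definition dart : finType := (edge G * bool)%type.

Definition drev (d : dart) : dart := (d.1, ~~ d.2).
Definition tail (d : dart) : vertex G :=
  if d.2 then (ends d.1).1 else (ends d.1).2.
Definition head (d : dart) : vertex G := tail (drev d).

(* Spanning subgraphs (containing all vertices) are identified with their sets
   of edges. *)
Definition adj (F : {set edge G}) : rel (vertex G) :=
  fun x y => [exists d : dart, [&& d.1 \in F, tail d == x & head d == y]].

Definition connected_graph : Prop :=
  forall x y : vertex G, connect (adj [set: edge G]) x y.

Definition components (F : {set edge G}) : {set {set vertex G}} :=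
  [set [set y | connect (adj F) x y] | x : vertex G].

(* Distinctness of the edges only matters for walks of length 2: it excludes
   going back and forth along one edge. Loops are walks of length 1. *)
Definition simple_closed_walk (s : seq dart) : bool :=
  [&& s != [::], cycle (fun d d' => head d == tail d') s,
      uniq [seq tail d | d <- s] & uniq [seq d.1 | d <- s]].

(* An oriented simple cycle has no base point, so it is encoded as the set of
   its darts, i.e. a set of darts which can be listed as a simple closed
   walk. *)
Definition is_ocycle (g : {set dart}) : bool :=
  has simple_closed_walk (permutations (enum g)).

Definition crev (g : {set dart}) : {set dart} := [set drev d | d in g].

(* The unoriented cycle underlying [g], as the pair of its two orientations
   (distinct if [g] is an oriented cycle, which uses each edge only once). *)
Definition unorient (g : {set dart}) : {set {set dart}} := [set g; crev g].

Definition cedges (c : {set {set dart}}) : {set edge G} :=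
  \bigcup_(g in c) [set d.1 | d : dart in g].

Definition cverts (c : {set {set dart}}) : {set vertex G} :=
  \bigcup_(g in c) [set tail d | d in g].

Definition cycles (F : {set edge G}) : {set {set {set dart}}} :=
  [set c in [set unorient g | g : {set dart} & is_ocycle g] |
    cedges c \subset F].

Definition cycles_in (F : {set edge G}) (K : {set vertex G}) :
    {set {set {set dart}}} :=
  [set c in cycles F | cverts c \subset K].

Definition ecrsf (W : {set vertex G}) (F : {set edge G}) : bool :=
  [forall K in components F,
    ([disjoint K & W] && (#|cycles_in F K| == 1)%N)
    || ((#|cycles_in F K| == 0)%N && (#|K :&: W| == 1)%N)].

Definition ecrsfs (W : {set vertex G}) : {set {set edge G}} :=
  [set F | ecrsf W F].

Definition all_edges (C : {set {set {set dart}}}) : {set edge G} :=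
  \bigcup_(c in C) cedges c.

Definition extremities (S : {set edge G}) : {set vertex G} :=
  [set x | [exists e in S, (x == (ends e).1) || (x == (ends e).2)]].

(* A weight function is a function on all sets of darts, of which only the
   values on oriented cycles are ever used. *)
Variables (R : realFieldType) (w : {set dart} -> R).

(* For [c = unorient g] the inner sum is [w g + w (crev g)]. *)
Definition weight (F : {set edge G}) : R :=
  \prod_(c in cycles F) \sum_(g in c) w g.

Variable W : {set vertex G}.

Definition partition_fun : R := \sum_(F in ecrsfs W) weight F.

(* Extended by 0 to all spanning subgraphs, so that laws on [ecrsfs W] for
   different sets [W] live on the same space. *)
Definition mu (F : {set edge G}) : R :=
  if F \in ecrsfs W then weight F / partition_fun else 0.

Definition pos_cycles : {set {set {set dart}}} :=
  [set c in cycles [set: edge G] |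
    [disjoint cverts c & W] && [exists g in c, 1 < w g]].

Definition pos_cycles_of (F : {set edge G}) : {set {set {set dart}}} :=
  cycles F :&: pos_cycles.

(* The values on cycles meeting [W], where the weight is left unspecified, are
   irrelevant: such cycles occur in no ECRSF with respect to a superset of
   [W]. *)
Definition wminus (g : {set dart}) : R :=
  if unorient g \in pos_cycles then 0 else w g.

End Graphs.

Section FiniteProbability.
Variables (R : realFieldType) (T : finType) (P : T -> R).

Definition Pr (B : {set T}) : R := \sum_(x in B) P x.

Definition condPr (B D : {set T}) : R := Pr (B :&: D) / Pr D.

End FiniteProbability.

(* Main.v *)
Require Import Defs.
From HB Require Import structures.
From mathcomp Require Import all_boot all_order all_algebra.
From mathcomp Require Import ring.

Set Implicit Arguments.
Unset Strict Implicit.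
Unset Printing Implicit Defensive.

Import Order.TTheory GRing.Theory Num.Theory.
Local Open Scope ring_scope.

(** Deleting the positive cycles and gluing them back are inverse bijections,
    and both change weights by one constant factor.

    Write [E] for the set of edges of the cycles in [C] and [A] for the set of
    their vertices. The cycles of an ECRSF lie in distinct components, so those
    in [C] are vertex-disjoint and avoid [W].

    Deleting [E] from an ECRSF [F] for [W] that contains [C]
    ([ecrsf_remove]). A component without a vertex of [A] is untouched.
    In a component carrying the cycle [c] of [C], every vertex keeps a path to
    [c], namely the part of an old path before its first visit to [A]; and two
    vertices of [c] cannot stay joined, since such a join, completed by an arc
    of [c], would be a second cycle in the component ([chord_new_cycle]). So the
    component falls apart into trees, each with exactly one vertex of
    [A :|: W].

    Adding [E] to an ECRSF [F] for [A :|: W] ([ecrsf_restore]).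
    Vertices of [A] lie in distinct components of [F], so a simple closed walk
    which leaves [A] through an edge of [F] can only return to [A] where it
    left. Hence a simple closed walk in [F :|: E] stays in [F] or follows a
    single cycle of [C], and the cycles of [F :|: E] are exactly those of [F]
    and those in [C] ([cycles_restore]). Each component meeting [A] consists of
    the trees hanging from one cycle of [C].

    Thus the ECRSFs for [W] whose set of positive cycles is [C] correspond
    to the ECRSFs for [A :|: W] without positive cycle
    ([restore_admissible]). The weight of [F :|: E] is the weight of [F]
    times the weight of the cycles in [C] ([weight_restore]), and [wminus]
    agrees with [w] on the configurations without positive cycle and gives
    weight zero to the others ([weight_wminus]). The constant factor and the
    partition function of [w] cancel in the conditional probability. *)

Section CycleSurgery.
Variable G : graph.
Implicit Types (d : dart G) (s t : seq (dart G)) (g : {set dart G}).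
Implicit Types (c : {set {set dart G}}) (C : {set {set {set dart G}}}).
Implicit Types (F S : {set edge G}) (W K : {set vertex G}) (x y z : vertex G).

(** * Darts and connectivity *)

Local Notation head := (@Defs.head G).
Local Notation consecutive := (fun d d' : dart G => head d == tail d').

Lemma drevK : involutive (@drev G).
Proof. by case=> e b; rewrite /drev /= negbK. Qed.

Lemma head_drev d : head (drev d) = tail d.
Proof. by rewrite /head drevK. Qed.

Lemma same_edge d d' : d.1 = d'.1 -> d = d' \/ d = drev d'.
Proof.
by case: d d' => e [] [e' []] /= ->; rewrite /drev /=; [left|right|right|left].
Qed.

Lemma adjP F x y :
  reflect (exists d, [/\ d.1 \in F, tail d = x & head d = y]) (adj F x y).
Proof.
apply: (iffP existsP) => -[d].
  by case/and3P=> dF /eqP tx /eqP hy; exists d.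
by case=> dF tx hy; exists d; rewrite dF tx hy !eqxx.
Qed.

Lemma adj_connect F d : d.1 \in F -> connect (adj F) (tail d) (head d).
Proof. by move=> dF; apply/connect1/adjP; exists d. Qed.

Lemma connect_adjC F : connect_sym (adj F).
Proof.
apply: sym_connect_sym => x y.
by apply/adjP/adjP => -[d [dF tx hy]]; exists (drev d); rewrite head_drev.
Qed.

Lemma connect_adjS F F' x y :
  F \subset F' -> connect (adj F) x y -> connect (adj F') x y.
Proof.
move=> sFF'; apply: connect_sub => {x y} x y /adjP[d [dF <- <-]].
exact: adj_connect (subsetP sFF' _ dF).
Qed.

Lemma connect_adj_ind F (P : vertex G -> Prop) x y :
    P x -> (forall d, d.1 \in F -> P (tail d) -> P (head d)) ->
  connect (adj F) x y -> P y.
Proof.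
move=> Px step /connectP[p + ->]; elim: p x Px => //= z p IHp x Px.
by case/andP=> /adjP[d [dF dx dz]]; apply: IHp; rewrite -dz; apply: step; rewrite ?dx.
Qed.

Lemma extremitiesP S x :
  reflect (exists2 d, d.1 \in S & tail d = x) (x \in extremities S).
Proof.
rewrite inE; apply: (iffP exists_inP) => [[e eS]|[[e b] /= eS <-]].
  by case/orP=> /eqP->; [exists (e, true)|exists (e, false)].
by exists e => //; case: b; rewrite /tail /= eqxx ?orbT.
Qed.

Lemma head_extremities S d : d.1 \in S -> head d \in extremities S.
Proof. by move=> dS; apply/extremitiesP; exists (drev d). Qed.

(** * Simple closed walks *)

(** A closed walk can be started at any of its darts, so a property
    inherited by each dart from its predecessor spreads to the whole walk as
    soon as one dart has it. *)
Lemma closed_walk_ind s (P : dart G -> Prop) d :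
    cycle consecutive s -> d \in s -> P d ->
    {in s &, forall d1 d2, head d1 = tail d2 -> P d1 -> P d2} ->
  {in s, forall d', P d'}.
Proof.
move=> cyc_s sd Pd step; have [i s' def_s] := rot_to sd.
have: path consecutive d s'.
  by move: cyc_s; rewrite -(rot_cycle i) def_s /= rcons_path => /andP[].
have: {subset d :: s' <= s} by move=> d'; rewrite -def_s mem_rot.
move=> sub pth d'; rewrite -(mem_rot i) def_s => {def_s}.
elim: s' d sd Pd sub pth d' => [|d2 s' IHs] d sd Pd sub /=.
  by move=> _ d'; rewrite inE => /eqP->.
case/andP=> /eqP dd2 pth d'; rewrite inE => /predU1P[-> //|].
have sd2: d2 \in s by apply: sub; rewrite !inE eqxx orbT.
apply: IHs => // [|z zs]; first exact: step dd2 Pd.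
by apply: sub; rewrite inE zs orbT.
Qed.

Lemma closed_walk_next s d : simple_closed_walk s -> d \in s ->
  exists2 d', d' \in s & head d = tail d'.
Proof.
case/and4P=> _ cyc_s _ _ sd; exists (next s d); first by rewrite mem_next.
exact/eqP/(next_cycle cyc_s sd).
Qed.

Lemma uniq_map_injective (T1 T2 : eqType) (f : T1 -> T2) (r : seq T1) :
  uniq (map f r) -> {in r &, injective f}.
Proof.
elim: r => //= a r IHr /andP[fa ur] x y.
rewrite !inE => /predU1P[->|xr] /predU1P[->|yr] //; last exact: IHr.
  by move=> fy; rewrite fy map_f in fa.
by move=> fx; rewrite -fx map_f in fa.
Qed.

Lemma closed_walk_tail_inj s : simple_closed_walk s -> {in s &, injective (@tail G)}.
Proof. by case/and4P=> _ _ ut _; apply: uniq_map_injective. Qed.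

Lemma closed_walk_edge_inj s :
  simple_closed_walk s -> {in s &, injective (fun d : dart G => d.1)}.
Proof. by case/and4P=> _ _ _ ue; apply: uniq_map_injective. Qed.

Lemma closed_walk_uniq s : simple_closed_walk s -> uniq s.
Proof. by case/and4P=> _ _ /map_uniq. Qed.

Lemma closed_walk_head_inj s : simple_closed_walk s -> {in s &, injective head}.
Proof.
move=> ws d d' sd sd' hdd'; have us := closed_walk_uniq ws.
case/and4P: (ws) => _ cyc_s _ _.
apply: (can_inj (prev_next us)); apply: (closed_walk_tail_inj ws); rewrite ?mem_next //.
by rewrite -(eqP (next_cycle cyc_s sd)) -(eqP (next_cycle cyc_s sd')).
Qed.

Lemma closed_walk_rev s :
  simple_closed_walk s -> simple_closed_walk (rev (map (@drev G) s)).
Proof.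
move=> ws; case/and4P: (ws) => nz_s cyc_s ut ue; apply/and4P; split.
- by rewrite -size_eq0 size_rev size_map size_eq0.
- rewrite rev_cycle cycle_map; apply: sub_cycle cyc_s => d d' /=.
  by rewrite head_drev -/(head d) eq_sym.
- rewrite map_rev rev_uniq -map_comp map_inj_in_uniq ?closed_walk_uniq //.
  exact: closed_walk_head_inj.
by rewrite map_rev rev_uniq -map_comp.
Qed.

Lemma unorient_crev g : unorient (crev g) = unorient g.
Proof.
suff crevK : crev (crev g) = g by rewrite /unorient crevK setUC.
rewrite /crev -imset_comp -[RHS]imset_id; apply: eq_imset; exact: drevK.
Qed.

Lemma unorient_rev s :
  unorient [set d in rev (map (@drev G) s)] = unorient [set d in s].
Proof.
rewrite -[RHS]unorient_crev; congr unorient; apply/setP=> d.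
rewrite inE mem_rev; apply/mapP/imsetP => -[d' sd' ->]; exists d' => //.
  by rewrite inE.
by rewrite inE in sd'.
Qed.

(** A simple closed walk living on the edges of another one cannot turn
    back: at each vertex, the only dart continuing without reusing the edge just
    traversed is the next dart of the other walk. So it runs once around, in one
    of the two directions. *)
Lemma closed_walk_sub_edges s t :
    simple_closed_walk s -> simple_closed_walk t ->
    {subset [seq d.1 | d <- s] <= [seq d.1 | d <- t]} ->
  unorient [set d in s] = unorient [set d in t].
Proof.
move=> ws wt sub_st; have /and4P[nz_s cyc_s _ _] := ws.
have [d sd]: exists d, d \in s.
  by case: (s) nz_s => // d s' _; exists d; rewrite mem_head.
(* Up to reversing [t], both walks traverse the edge of [d] in the same
   direction. *)
wlog td: t wt sub_st / d \in t.
  move=> IH; have /mapP[d' td' dd'] := sub_st _ (map_f _ sd).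
  case: (same_edge dd') => def_d; first by apply: IH; rewrite ?def_d.
  rewrite -(unorient_rev t); apply: IH; first exact: closed_walk_rev.
    by move=> e /sub_st; rewrite map_rev -map_comp mem_rev.
  by rewrite mem_rev def_d map_f.
have /and4P[_ cyc_t _ _] := wt.
have sub: {in s, forall d, d \in t}.
  apply: closed_walk_ind cyc_s sd td _ => d1 d2 sd1 sd2 h12 td1.
  have /mapP[d3 td3 d23] := sub_st _ (map_f _ sd2).
  have [-> //|def_d2] := same_edge d23.
  have d31: d3 = d1.
    by apply: (closed_walk_head_inj wt) => //; rewrite h12 def_d2 -head_drev drevK.
  by rewrite (closed_walk_edge_inj ws sd2 sd1) // d23 d31.
congr unorient; apply/setP=> d'; rewrite !inE; apply/idP/idP; first exact: sub.
move: d'; apply: (closed_walk_ind cyc_t td sd) => d1 d2 td1 td2 h12 sd1.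
have [d3 sd3 h13] := closed_walk_next ws sd1.
by rewrite (closed_walk_tail_inj wt td2 (sub _ sd3)) // -h12.
Qed.

(** * Unoriented cycles *)

(** Gives access to cycles through walks: of the two orientations of [c]
    only one needs to be exhibited as a walk. *)
Lemma cyclesP F c :
  reflect (exists s, [/\ simple_closed_walk s, {in s, forall d, d.1 \in F}
                       & c = unorient [set d in s]]) (c \in cycles F).
Proof.
have cedgesE g : cedges (unorient g) = [set d.1 | d : dart G in g].
  rewrite /cedges bigcup_setU !big_set1 /crev -imset_comp; exact: setUid.
apply: (iffP idP) => [|[s [ws sF ->]]].
  rewrite inE => /andP[/imsetP[g]]; rewrite inE => /hasP[s].
  rewrite mem_permutations => /perm_mem gs ws -> sF.
  have def_g : g = [set d in s] by apply/setP=> d; rewrite inE gs mem_enum.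
  exists s; split=> // [d sd|]; last by rewrite def_g.
  apply: (subsetP sF); rewrite cedgesE; apply/imsetP; exists d => //.
  by rewrite def_g inE.
rewrite inE; apply/andP; split.
  apply/imsetP; exists [set d in s] => //; rewrite inE; apply/hasP; exists s => //.
  rewrite mem_permutations uniq_perm ?enum_uniq ?closed_walk_uniq //.
  by move=> d; rewrite mem_enum inE.
by rewrite cedgesE; apply/subsetP=> e /imsetP[d]; rewrite inE => /sF dF ->.
Qed.

Lemma mem_cedges s e :
  (e \in cedges (unorient [set d in s])) = (e \in [seq d.1 | d <- s]).
Proof.
rewrite /cedges bigcup_setU !big_set1 /crev -imset_comp setUid.
by apply/imsetP/mapP => -[d sd ->]; exists d => //; move: sd; rewrite inE.
Qed.

(** Each head along a closed walk is the next tail, so both orientations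
    visit all the ends of their edges. *)
Lemma cverts_extremities F c : c \in cycles F -> cverts c = extremities (cedges c).
Proof.
case/cyclesP=> s [_ _ ->]; apply/setP=> x; apply/bigcupP/extremitiesP.
  case=> g; rewrite !inE => /orP[]/eqP-> /imsetP[d gd ->].
    by exists d => //; rewrite mem_cedges map_f //; move: gd; rewrite inE.
  case/imsetP: gd => d'; rewrite inE => sd' ->.
  by exists (drev d') => //; rewrite mem_cedges /= (map_f (fun d : dart G => d.1)).
case=> d; rewrite mem_cedges => /mapP[d' sd' /same_edge dd'] <-.
case: dd' => ->.
  by exists [set d in s]; rewrite ?inE ?eqxx ?imset_f ?inE.
exists (crev [set d in s]); rewrite ?inE ?eqxx ?orbT //.
by rewrite imset_f // imset_f // inE.
Qed.

Lemma mem_cverts s x : simple_closed_walk s ->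
  (x \in cverts (unorient [set d in s])) = (x \in [seq tail d | d <- s]).
Proof.
move=> ws; have cs: unorient [set d in s] \in cycles [set: edge G].
  by apply/cyclesP; exists s; split=> // d _; rewrite inE.
rewrite (cverts_extremities cs); apply/extremitiesP/mapP => [[d]|[d sd ->]].
  rewrite mem_cedges => /mapP[d' sd' /same_edge[]->] <-; first by exists d'.
  exact: closed_walk_next.
by exists d => //; rewrite mem_cedges map_f.
Qed.

Lemma cycles_cedges F c : c \in cycles F -> cedges c \subset F.
Proof. by rewrite inE => /andP[]. Qed.

Lemma cyclesS F F' : F \subset F' -> cycles F \subset cycles F'.
Proof.
move=> sFF'; apply/subsetP=> c; rewrite !inE => /andP[-> /=].
by move/subset_trans; apply.
Qed.

Lemma cycles_edge F c : c \in cycles F -> exists d, d.1 \in cedges c.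
Proof.
case/cyclesP=> -[|d s] [ws _ ->] //.
by exists d; rewrite mem_cedges mem_head.
Qed.

Lemma cycles_connect F c x y : c \in cycles F ->
  x \in cverts c -> y \in cverts c -> connect (adj F) x y.
Proof.
case/cyclesP=> s [ws sF ->]; rewrite !mem_cverts // => /mapP[d sd ->] /mapP[d' sd' ->].
case/and4P: (ws) => _ cyc_s _ _.
apply: (closed_walk_ind (P := fun d' => connect _ _ (tail d')) cyc_s sd) sd' => //.
move=> d1 d2 sd1 sd2 <- /connect_trans; apply; exact/adj_connect/sF.
Qed.

Lemma path_connect F d s : path consecutive d s -> {in s, forall d', d'.1 \in F} ->
  connect (adj F) (head d) (head (last d s)).
Proof.
elim: s d => //= d' s IHs d /andP[/eqP-> pth] sF.
apply: (connect_trans (adj_connect (sF _ (mem_head _ _)))); apply: IHs => // z zs.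
by apply: sF; rewrite inE zs orbT.
Qed.

(** Of several parallel edges between consecutive vertices of a path one
    has to be chosen; since no vertex repeats, the chosen edges are distinct. *)
Lemma connect_dart_path F x y : connect (adj F) x y ->
  exists s, [/\ map (@tail G) s = belast x (map head s), last x (map head s) = y,
    {in s, forall d, d.1 \in F}, uniq (x :: map head s) & uniq [seq d.1 | d <- s]].
Proof.
case/connectP=> p /shortenP[{}p pth up _ ->].
suff [s [hs ts sF ue]] : exists s, [/\ map head s = p, map (@tail G) s = belast x p,
    {in s, forall d, d.1 \in F} & uniq [seq d.1 | d <- s]].
  by exists s; rewrite hs.
elim: p x pth up => [|z p IHp] x; first by exists [::].
case/andP=> /adjP[d [dF dx dz]] /IHp{}IHp.
rewrite cons_uniq => /andP[xp] /IHp[s [hs ts sF ue]].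
exists (d :: s); split=> /=; rewrite ?hs ?ts ?dx ?dz //.
  by move=> d'; rewrite inE => /predU1P[->|/sF].
rewrite ue andbT; apply: contra xp => /mapP[d' sd' /same_edge dd'].
have td' : tail d' \in z :: p by apply: mem_belast; rewrite -ts map_f.
have hd' : head d' \in z :: p by rewrite inE -hs map_f ?orbT.
by rewrite -dx; case: dd' => ->.
Qed.

(** A vertex-simple path between the ends of a missing edge is closed up
    by this edge. *)
Lemma cycle_through_edge F d : d.1 \notin F -> connect (adj F) (head d) (tail d) ->
  exists2 c, c \in cycles (d.1 |: F) & d.1 \in cedges c.
Proof.
move=> dF /connect_dart_path[s [ts hs sF us ue]].
exists (unorient [set d' in d :: s]); last by rewrite mem_cedges mem_head.
apply/cyclesP; exists (d :: s); split=> // [|d']; last first.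
  by rewrite !inE => /predU1P[->|/sF->]; rewrite ?eqxx ?orbT.
apply/and4P; split=> //.
- rewrite /= rcons_path -last_map hs eqxx andbT.
  elim: s (d) ts {dF sF us ue hs} => //= d1 s IHs d0 [<- ts].
  by rewrite eqxx IHs.
- by rewrite /= ts -[X in X \in _]hs -rcons_uniq -lastI.
by rewrite /= ue andbT; apply: contra dF => /mapP[d' /sF d'F ->].
Qed.

(** Two vertices of a cycle [c] joined outside [c] produce a second cycle.
    The two edges of [c] at [x] are deleted: the arc of [c] that remains still
    joins the other end of the first one to [y], and [y] is joined to [x] outside
    [c], so the first edge lies on a cycle which avoids the second. *)
Lemma chord_new_cycle F c x y : c \in cycles F -> x \in cverts c -> y \in cverts c ->
    x != y -> connect (adj (F :\: cedges c)) x y ->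
  exists2 c', c' \in cycles F & (c' != c) && (x \in cverts c').
Proof.
case/cyclesP=> s [ws sF def_c] cx cy xy con_xy.
move: cx; rewrite def_c mem_cverts // => /mapP[d sd def_x].
have [i s' def_s] := rot_to sd.
move: cy; rewrite def_c mem_cverts // -(mem_rot i) -map_rot def_s /=.
rewrite inE def_x in xy *; rewrite eq_sym (negPf xy) /= => /mapP[d' sd' def_y].
have [_ cyc_s _ ue] := and4P ws.
move: cyc_s ue; rewrite -(rot_cycle i) -(rot_uniq i) -map_rot def_s /=.
case/splitPr: s' / sd' def_s => p q def_s.
rewrite rcons_path cat_path /= => /andP[/and3P[pth_p /eqP hd' _] _].
rewrite map_cat cat_uniq => /and4P[d_pq _ pq _].
(* [d] leaves [x] along [c], and [d2] is the dart of [c] entering [x]; the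
   two edges differ because [d'] starts at [y], not at [x]. *)
set d2 := last d' q.
have d2q : d2 \in d' :: q by apply: mem_last.
have sd2 : d2 \in s by rewrite -(mem_rot i) def_s inE mem_cat d2q !orbT.
pose F2 := F :\: [set d.1; d2.1].
have [||c' c'F d_c'] := @cycle_through_edge F2 d; first by rewrite !inE eqxx.
  rewrite connect_adjC -def_x; apply: (@connect_trans _ _ y).
    apply: connect_adjS con_xy; apply/setDS/subsetP => e; rewrite def_c mem_cedges.
    by case/set2P=> ->; apply: map_f.
  rewrite connect_adjC def_y -hd'; apply: path_connect pth_p _ => d3 pd3.
  rewrite !inE sF -1?(mem_rot i) ?def_s ?inE ?mem_cat ?pd3 ?orbT // andbT.
  apply/norP; split; apply/eqP => ed.
    by case/negP: d_pq; rewrite -map_cat -ed map_f // mem_cat pd3.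
  by case/hasP: pq; exists d2.1; [apply: map_f d2q | rewrite /= -ed map_f].
have dF : d.1 \in F by apply: sF.
have subF : d.1 |: F2 \subset F by rewrite subUset sub1set dF subsetDl.
have {}c'F' := subsetP (cyclesS subF) _ c'F.
exists c' => //; apply/andP; split; last first.
  by rewrite (cverts_extremities c'F'); apply/extremitiesP; exists d.
apply/eqP=> cc'; have /subsetP/(_ d2.1) := cycles_cedges c'F.
rewrite cc' mem_cedges map_f // => /(_ isT); rewrite !inE eqxx orbT orbF.
move/eqP=> dd2; case/negP: d_pq; rewrite -map_cat -dd2 map_f //.
by rewrite mem_cat d2q orbT.
Qed.

(** * Removing and restoring a family of cycles *)

Definition component F x : {set vertex G} := [set y | connect (adj F) x y].

Lemma in_component F x y : (y \in component F x) = connect (adj F) x y.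
Proof. by rewrite inE. Qed.

Lemma in_cycles_in F K c : (c \in cycles_in F K) = (c \in cycles F) && (cverts c \subset K).
Proof. by rewrite inE. Qed.

Lemma ecrsfP W F :
  reflect (forall x,
      ([disjoint component F x & W] /\
        exists c, cycles_in F (component F x) = [set c])
   \/ (cycles_in F (component F x) = set0 /\
        exists v, component F x :&: W = [set v]))
    (ecrsf W F).
Proof.
apply: (iffP forall_inP) => [ecF x | ecF _ /imsetP[x _ ->]].
  have /orP[/andP[? /cards1P ?]|] := ecF _ (imset_f (component F) (isT : x \in predT)).
    by left.
  by rewrite cards_eq0 => /andP[/eqP-> /cards1P]; right.
case: (ecF x) => -[].
  by rewrite /component => -> [c ->]; rewrite cards1.
by rewrite /component => -> [v ->]; rewrite cards0 cards1 orbT.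
Qed.

Lemma mem_cycles_in F c x y : c \in cycles F -> x \in cverts c ->
  connect (adj F) y x -> c \in cycles_in F (component F y).
Proof.
move=> cF cx con_yx; rewrite inE cF; apply/subsetP=> z cz; rewrite inE.
exact: connect_trans con_yx (cycles_connect cF cx cz).
Qed.

Lemma ecrsf_cycle_component W F c x y : ecrsf W F -> c \in cycles F ->
    x \in cverts c -> connect (adj F) y x ->
  [disjoint component F y & W] /\ cycles_in F (component F y) = [set c].
Proof.
move=> /ecrsfP/(_ y) ecF cF cx con_yx; have := mem_cycles_in cF cx con_yx.
case: ecF => [[-> [c' ->]] | [-> _]]; last by rewrite inE.
by rewrite inE => /eqP->.
Qed.

Definition vertex_disjoint C := forall c c' x,
  c \in C -> c' \in C -> x \in cverts c -> x \in cverts c' -> c = c'.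

Lemma ecrsf_vertex_disjoint W F : ecrsf W F -> vertex_disjoint (cycles F).
Proof.
move=> ecF c c' x cF c'F cx c'x.
have [_ def_c] := ecrsf_cycle_component ecF cF cx (connect0 _ x).
have := mem_cycles_in c'F c'x (connect0 _ x).
by rewrite def_c inE => /eqP.
Qed.

Lemma vertex_disjointS C C' : C \subset C' -> vertex_disjoint C' -> vertex_disjoint C.
Proof. by move=> /subsetP sCC' disC' c c' x /sCC' cC /sCC' c'C; apply: disC'. Qed.

Lemma ecrsf_cycle_avoids W F c x : ecrsf W F -> c \in cycles F -> x \in cverts c ->
  x \notin W.
Proof.
move=> ecF cF cx; have [dis _] := ecrsf_cycle_component ecF cF cx (connect0 _ x).
by rewrite (disjointFr dis) // inE.
Qed.

Section Surgery.
Variables (F0 : {set edge G}) (C : {set {set {set dart G}}}).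
Hypothesis C_cycles : C \subset cycles F0.

Let E := all_edges C.
Let A := extremities E.

Lemma mem_all_edges d c : c \in C -> d.1 \in cedges c -> d.1 \in E.
Proof. by move=> cC dc; apply/bigcupP; exists c. Qed.

Lemma tail_cverts d c : c \in C -> d.1 \in cedges c -> tail d \in cverts c.
Proof.
move=> cC dc; rewrite (cverts_extremities (subsetP C_cycles _ cC)).
by apply/extremitiesP; exists d.
Qed.

Lemma head_cverts d c : c \in C -> d.1 \in cedges c -> head d \in cverts c.
Proof. by move=> cC dc; apply: (@tail_cverts (drev d)). Qed.

Lemma extremities_cverts x : reflect (exists2 c, c \in C & x \in cverts c) (x \in A).
Proof.
apply: (iffP (extremitiesP E x)) => [[d /bigcupP[c cC dc] <-] | [c cC]].
  by exists c => //; apply: tail_cverts.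
rewrite (cverts_extremities (subsetP C_cycles _ cC)) => /extremitiesP[d dc <-].
by exists d => //; apply: mem_all_edges dc.
Qed.

Lemma all_edges_sub : E \subset F0.
Proof.
apply/bigcupsP=> c cC; exact: cycles_cedges (subsetP C_cycles _ cC).
Qed.

(** A cycle outside [C] is vertex-disjoint from the cycles in [C], so it
    loses no edge. *)
Lemma cycles_remove : vertex_disjoint (cycles F0) ->
  cycles (F0 :\: E) = cycles F0 :\: C.
Proof.
move=> disF; apply/setP=> c; rewrite in_setD andbC; apply/idP/andP => [cF' | [cF cC]].
  have cF := subsetP (cyclesS (subsetDl _ _)) _ cF'; split=> //.
  apply/negP=> cC; have [d dc] := cycles_edge cF'.
  have := subsetP (cycles_cedges cF') _ dc.
  by rewrite inE (mem_all_edges cC dc).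
case/cyclesP: (cF) => s [ws sF def_c]; apply/cyclesP; exists s; split=> // d sd.
rewrite inE sF // andbT; apply: contra cC => /bigcupP[c' c'C dc'].
suff -> : c = c' by [].
apply: (disF _ _ (tail d)) => //; first exact: (subsetP C_cycles).
  by rewrite def_c mem_cverts // map_f.
exact: tail_cverts dc'.
Qed.

(** An edge of [E] has its tail in [A], so a path either survives or
    reaches [A] before its first deleted edge. *)
Lemma connect_remove_or_hit x y : connect (adj F0) x y ->
  connect (adj (F0 :\: E)) x y \/ exists2 a, a \in A & connect (adj (F0 :\: E)) x a.
Proof.
pose hit z := connect (adj (F0 :\: E)) x z
  \/ exists2 a, a \in A & connect (adj (F0 :\: E)) x a.
apply: (@connect_adj_ind F0 hit); first by left.
move=> d dF [con_xd|]; last by right.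
have [dE | dE] := boolP (d.1 \in E).
  by right; exists (tail d) => //; apply/extremitiesP; exists d.
by left; apply: connect_trans con_xd _; apply: adj_connect; rewrite inE dE.
Qed.

Lemma ecrsf_remove W : ecrsf W F0 -> ecrsf (A :|: W) (F0 :\: E).
Proof.
move=> ecF; have disF := ecrsf_vertex_disjoint ecF.
apply/ecrsfP=> x; have sub := @connect_adjS _ _ x _ (subsetDl F0 E).
have [/exists_inP[a aA con_xa] | noA] := boolP [exists a in A, connect (adj F0) x a].
  have [c cC ca] := extremities_cverts _ aA.
  have cF := subsetP C_cycles _ cC.
  have [disW only_c] := ecrsf_cycle_component ecF cF ca con_xa.
  right; split.
    apply/setP=> c'; rewrite in_set0 in_cycles_in cycles_remove //; apply/negbTE/negP.
    rewrite in_setD => /andP[/andP[c'C c'F]] /subsetP c'x.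
    have: c' \in cycles_in F0 (component F0 x).
      by rewrite in_cycles_in c'F; apply/subsetP=> z /c'x; rewrite !in_component => /sub.
    by rewrite only_c inE => /eqP def_c'; rewrite def_c' cC in c'C.
  have [v vA con_xv] : exists2 v, v \in A & connect (adj (F0 :\: E)) x v.
    by have [con'_xa|//] := connect_remove_or_hit con_xa; exists a.
  (* Each surviving component hanging from [c] meets [A] only on [c], since the
     cycles of [C] are alone in their components. *)
  have in_c z : z \in A -> connect (adj (F0 :\: E)) x z -> z \in cverts c.
    case/extremities_cverts=> c' c'C c'z /sub con_xz.
    have := mem_cycles_in (subsetP C_cycles _ c'C) c'z con_xz.
    by rewrite only_c inE => /eqP <-.
  exists v; apply/setP=> z; rewrite in_setI in_setU in_set1 in_component; apply/andP/eqP => [[con_xz]|->]; last first.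
    by split=> //; rewrite vA.
  case/orP=> [zA | zW]; last first.
    by move/sub: con_xz; rewrite -in_component => /(disjointFr disW); rewrite zW.
  apply/eqP/negPn/negP=> zv.
  have con_zv : connect (adj (F0 :\: E)) z v.
    by apply: connect_trans con_xv; rewrite connect_adjC.
  have [cz cv] := (in_c z zA con_xz, in_c v vA con_xv).
  have [|c' c'F /andP[c'c c'z]] := chord_new_cycle cF cz cv zv.
    apply: connect_adjS con_zv; apply: setDS; exact: bigcup_sup.
  by case/eqP: c'c; apply: disF c'z cz.
have comp_eq : component (F0 :\: E) x = component F0 x.
  apply/setP=> y; rewrite !inE; apply/idP/idP; first exact: sub.
  move=> con_xy; have [//|[a aA /sub con_xa]] := connect_remove_or_hit con_xy.
  by case/exists_inP: noA; exists a.
have cyc_eq : cycles_in (F0 :\: E) (component F0 x) = cycles_in F0 (component F0 x).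
  apply/setP=> c; rewrite !in_cycles_in cycles_remove // in_setD -andbA andb_idl //.
  case/andP=> cF /subsetP cx; apply: contra noA => cC; have [d dc] := cycles_edge cF.
  apply/exists_inP; exists (tail d).
    by apply/extremitiesP; exists d => //; apply: mem_all_edges dc.
  by have := cx _ (tail_cverts cC dc); rewrite inE.
have W_eq : component F0 x :&: (A :|: W) = component F0 x :&: W.
  rewrite setIUr; apply/setUidPr/subsetP=> a; rewrite in_setI in_component => /andP[con_xa aA].
  by case/exists_inP: noA; exists a.
have disE (B : {set vertex G}) : [disjoint component F0 x & B] = (component F0 x :&: B == set0).
  by rewrite setI_eq0.
rewrite comp_eq cyc_eq disE W_eq -disE; exact: (ecrsfP _ _ ecF).
Qed.

Section Restore.
Variables (W : {set vertex G}) (F : {set edge G}).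
Hypotheses (C_disjoint : vertex_disjoint C)
  (C_avoids : forall c x, c \in C -> x \in cverts c -> x \notin W)
  (ecF : ecrsf (A :|: W) F).

(** The components of [F] which meet [A :|: W] are trees with a single
    root. *)
Lemma connect_roots x y : x \in A -> y \in A :|: W -> connect (adj F) x y -> x = y.
Proof.
move=> xA yAW con_xy.
have xK : x \in component F x :&: (A :|: W) by rewrite in_setI in_setU in_component connect0 xA.
have yK : y \in component F x :&: (A :|: W) by rewrite in_setI in_component con_xy.
case: (ecrsfP _ _ ecF x) => [[dis _] | [_ [v def_v]]].
  by move: dis xK; rewrite -setI_eq0 => /eqP->; rewrite in_set0.
by move: xK yK; rewrite def_v !in_set1 => /eqP-> /eqP->.
Qed.

Lemma cycle_avoids_roots c x y : c \in cycles F -> x \in cverts c -> y \in A ->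
  ~ connect (adj F) y x.
Proof.
move=> cF cx yA con_yx.
have [dis _] := ecrsf_cycle_component ecF cF cx con_yx.
have yK : y \in component F y by rewrite in_component.
by have := disjointFr dis yK; rewrite in_setU yA.
Qed.

(** An edge of [E] has both ends in [A]: in [F] it would join two roots, or
    be a loop in a tree. *)
Lemma restore_disjoint : [disjoint F & E].
Proof.
apply/pred0P=> e /=; apply/negbTE/negP => /andP[eF eE].
pose d : dart G := (e, true).
have td : tail d \in A by apply/extremitiesP; exists d.
have hd : head d \in A by apply: head_extremities.
have con := adj_connect (eF : d.1 \in F).
have loop : tail d = head d by apply: connect_roots con; rewrite // in_setU hd.
have cF : unorient [set d' in [:: d]] \in cycles F.
  apply/cyclesP; exists [:: d]; split=> //; last by move=> d'; rewrite inE => /eqP->.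
  by rewrite /simple_closed_walk /= loop eqxx.
apply: (cycle_avoids_roots cF _ td (connect0 _ _)).
by rewrite mem_cverts ?mem_head // /simple_closed_walk /= loop eqxx.
Qed.

(** A simple closed walk which uses an edge of [E] never enters [F]: it could
    leave the component of [F] it enters only at the root where it entered, and
    returning there closes the walk. Nor can it pass from one cycle of [C] to
    another, as these share no vertex. *)
Lemma cycles_restore : cycles (F :|: E) = C :|: cycles F.
Proof.
have E_cycle c d : c \in C -> d.1 \in E -> tail d \in cverts c -> d.1 \in cedges c.
  move=> cC /bigcupP[c' c'C dc'] dc; suff -> : c = c' by [].
  exact: C_disjoint dc (tail_cverts c'C dc').
apply/eqP; rewrite eqEsubset; apply/andP; split; last first.
  rewrite subUset (cyclesS (subsetUl _ _)) andbT; apply/subsetP=> c cC.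
  have /cyclesP[s [ws _ def_c]] := subsetP C_cycles _ cC.
  apply/cyclesP; exists s; split=> // d sd; rewrite inE orbC (@mem_all_edges _ c) //.
  by rewrite def_c mem_cedges map_f.
apply/subsetP=> c /cyclesP[s [ws sFE ->]]; have /and4P[_ cyc_s _ _] := ws.
have [/allP sF | /allPn[d0 sd0 d0F]] := boolP (all (fun d : dart G => d.1 \in F) s).
  by rewrite in_setU orbC; apply/orP; left; apply/cyclesP; exists s.
have: d0.1 \in E by have := sFE _ sd0; rewrite inE (negPf d0F).
case/bigcupP=> c0 c0C d0c0.
(* Starting from a root along an edge of [F], the walk remains in the component
   of this root until it is closed, since the next edge of [E] would have to
   start at the same root. *)
have stay d1 : d1 \in s -> tail d1 \in A -> d1.1 \in F -> {in s, forall d, d.1 \in F}.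
  move=> sd1 d1A d1F d sd.
  suff [//] : d.1 \in F /\ connect (adj F) (tail d1) (head d).
  move: d sd; apply: (closed_walk_ind cyc_s sd1); first by split=> //; apply: adj_connect.
  move=> d2 d3 sd2 sd3 h23 [d2F con12].
  have := sFE _ sd3; rewrite inE => /orP[d3F | d3E].
    by split=> //; apply: connect_trans con12 _; rewrite h23; apply: adj_connect.
  suff -> : d3 = d1 by split=> //; apply: adj_connect.
  apply: (closed_walk_tail_inj ws) => //; apply/esym.
  apply: connect_roots; rewrite // -?h23 // in_setU h23.
  by apply/orP; left; apply/extremitiesP; exists d3.
have sc0 : {in s, forall d, d.1 \in cedges c0}.
  apply: (closed_walk_ind cyc_s sd0) => // d1 d2 sd1 sd2 h12 d1c0.
  have d2c0 : tail d2 \in cverts c0 by rewrite -h12; apply: head_cverts.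
  have := sFE _ sd2; rewrite inE => /orP[d2F|]; last by move/E_cycle; apply.
  case/negP: d0F; apply: (stay d2) => //.
  by apply/extremities_cverts; exists c0.
suff -> : unorient [set d in s] = c0 by rewrite in_setU c0C.
have /cyclesP[t [wt _ def_c0]] := subsetP C_cycles _ c0C.
rewrite def_c0; apply: closed_walk_sub_edges => // e /mapP[d sd ->].
by rewrite -mem_cedges -def_c0 sc0.
Qed.

Lemma ecrsf_restore : ecrsf W (F :|: E).
Proof.
have sub x y := @connect_adjS _ _ x y (subsetUl F E).
(* The vertices hanging from [c] in [F] form a set closed under the edges of
   [F :|: E], hence a whole component: an edge of [E] leaving this set would
   start on [c], and belongs to [c]. *)
have reach x y c a : c \in C -> a \in cverts c -> connect (adj F) a x ->
    connect (adj (F :|: E)) x y ->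
  exists2 b, b \in cverts c & connect (adj F) b y.
  move=> cC ca con_ax; pose near z := exists2 b, b \in cverts c & connect (adj F) b z.
  apply: (@connect_adj_ind _ near) => [|d]; first by exists a.
  rewrite inE => dFE [b cb con_bd].
  have [dF | dF] := boolP (d.1 \in F).
    by exists b => //; apply: connect_trans con_bd (adj_connect dF).
  have dE : d.1 \in E by rewrite (negPf dF) in dFE.
  have bA : b \in A by apply/extremities_cverts; exists c.
  have dA : tail d \in A by apply/extremitiesP; exists d.
  have def_b : b = tail d by apply: connect_roots con_bd; rewrite // in_setU dA.
  case/bigcupP: dE => c' c'C dc'.
  have def_c : c = c'.
    by apply: C_disjoint cb _ => //; rewrite def_b; apply: tail_cverts.
  by exists (head d); rewrite ?connect0 // def_c head_cverts.
apply/ecrsfP=> x.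
have [/exists_inP[a aA con_ax] | noA] := boolP [exists a in A, connect (adj F) a x].
  have [c cC ca] := extremities_cverts _ aA.
  left; split.
    apply/pred0P=> y /=; apply/negbTE/negP; rewrite inE => /andP[con_xy yW].
    have [b cb con_by] := reach x y c a cC ca con_ax con_xy.
    have bA : b \in A by apply/extremities_cverts; exists c.
    have /negP[] := C_avoids cC cb.
    by rewrite (@connect_roots b y) // in_setU yW orbT.
  exists c; apply/setP=> c'; rewrite in_cycles_in in_set1 cycles_restore in_setU.
  apply/idP/eqP => [/andP[c'FC /subsetP c'x] | ->].
    have [y c'y] : exists y, y \in cverts c'.
      have c'FE : c' \in cycles (F :|: E) by rewrite cycles_restore in_setU.
      have [d dc'] := cycles_edge c'FE; exists (tail d).
      by rewrite (cverts_extremities c'FE); apply/extremitiesP; exists d.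
    have := c'x _ c'y; rewrite inE => /(reach x y c a cC ca con_ax)[b cb con_by].
    have bA : b \in A by apply/extremities_cverts; exists c.
    case/orP: c'FC => [c'C | c'F].
      have def_b : b = y.
        apply: connect_roots con_by => //; rewrite in_setU; apply/orP; left.
        by apply/extremities_cverts; exists c'.
      by apply: C_disjoint c'y _; rewrite // -def_b.
    by case: (cycle_avoids_roots c'F c'y bA).
  rewrite cC /=; apply/subsetP=> y cy; rewrite inE.
  apply: connect_trans (_ : connect _ a y).
    by apply: sub; rewrite connect_adjC.
  by apply: cycles_connect ca cy; rewrite cycles_restore in_setU cC.
have comp_eq : component (F :|: E) x = component F x.
  apply/setP=> y; rewrite !inE; apply/idP/idP; last exact: sub.
  apply: (@connect_adj_ind _ (fun z => connect (adj F) x z)) => // d; rewrite inE => /orP[dF con|dE con].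
    exact: connect_trans con (adj_connect dF).
  case/exists_inP: noA; exists (tail d); last by rewrite connect_adjC.
  by apply/extremitiesP; exists d.
have noAx y : y \in A -> connect (adj F) x y -> False.
  by move=> yA con; case/exists_inP: noA; exists y; rewrite // connect_adjC.
have cyc_eq : cycles_in (F :|: E) (component F x) = cycles_in F (component F x).
  apply/setP=> c; rewrite !in_cycles_in cycles_restore in_setU.
  case: (boolP (c \in C)) => //= cC; rewrite andb_idl // => /subsetP cx.
  have [d dc] := cycles_edge (subsetP C_cycles _ cC).
  case: (noAx (tail d)); first by apply/extremitiesP; exists d => //; apply: mem_all_edges dc.
  by have := cx _ (tail_cverts cC dc); rewrite inE.
have W_eq : component F x :&: (A :|: W) = component F x :&: W.
  rewrite setIUr; apply/setUidPr/subsetP=> a; rewrite in_setI in_component => /andP[con_xa aA].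
  by case: (noAx a).
have disE (B : {set vertex G}) : [disjoint component F x & B] = (component F x :&: B == set0).
  by rewrite setI_eq0.
rewrite comp_eq cyc_eq disE -W_eq -disE; exact: (ecrsfP _ _ ecF).
Qed.

End Restore.
End Surgery.

End CycleSurgery.

(** * Weights and laws *)

Section Weights.
Variables (R : realFieldType) (G : graph) (w : {set dart G} -> R).
Variables (W : {set vertex G}) (C : {set {set {set dart G}}}).
Implicit Types (F : {set edge G}) (B D : {set {set edge G}}).

Let E := all_edges C.
Let A := extremities E.

Lemma Pr_mu (v : {set dart G} -> R) (K : {set vertex G}) D :
  Pr (mu v K) D = (\sum_(F in D | F \in ecrsfs K) weight v F) / partition_fun v K.
Proof. by rewrite /Pr mulr_suml big_mkcondr. Qed.

Lemma cycle_orientation F c g : c \in cycles F -> g \in c -> unorient g = c.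
Proof.
case/cyclesP=> s [_ _ ->]; rewrite in_set2 => /orP[]/eqP-> //.
exact: unorient_crev.
Qed.

Lemma sum_wminus F c : c \in cycles F ->
  \sum_(g in c) wminus w W g = if c \in pos_cycles w W then 0 else \sum_(g in c) w g.
Proof.
move=> cF; rewrite (eq_bigr (fun g => if c \in pos_cycles w W then 0 else w g)).
  by case: ifP => // _; rewrite big1.
by move=> g gc; rewrite /wminus (cycle_orientation cF gc).
Qed.

(** A single positive cycle in [F] contributes a vanishing factor. *)
Lemma weight_wminus F :
  weight (wminus w W) F = if pos_cycles_of w W F == set0 then weight w F else 0.
Proof.
case: (set_0Vmem (pos_cycles_of w W F)) => [noF | [c]].
  rewrite noF eqxx; apply: eq_bigr => c cF; rewrite (sum_wminus cF).
  by have := in_set0 c; rewrite -noF in_setI cF /= => ->.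
move=> cP; have /setIP[cF cpos] := cP.
rewrite ifN; last by apply/set0Pn; exists c.
by rewrite /weight (bigD1 c) //= (sum_wminus cF) cpos mul0r.
Qed.

Variable F0 : {set edge G}.
Hypotheses (ecF0 : ecrsf W F0) (C_cycles : C \subset cycles F0)
  (C_pos : C \subset pos_cycles w W).

Lemma weight_restore F : ecrsf (A :|: W) F ->
  weight w (F :|: E) = (\prod_(c in C) \sum_(g in c) w g) * weight w F.
Proof.
move=> ecF; have disC := vertex_disjointS C_cycles (ecrsf_vertex_disjoint ecF0).
rewrite /weight (cycles_restore C_cycles disC ecF).
rewrite (eq_bigl [predU C & cycles F]) => [|c]; last by rewrite in_setU.
rewrite bigU //.
apply/pred0P=> c /=; apply/negbTE/negP => /andP[cC cF].
have [d dc] := cycles_edge cF.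
have := restore_disjoint ecF.
by move/pred0P/(_ d.1)/negP; case; rewrite /= (subsetP (cycles_cedges cF)) ?(mem_all_edges cC).
Qed.

(** Stated in the form of the side condition left by reindexing a sum over
    the configurations with positive cycles [C] along [F |-> F :|: E]: the last
    equation on the left says that [F] is recovered by deleting [E]. *)
Lemma restore_admissible F :
  ((F :|: E \in ecrsfs W) && (pos_cycles_of w W (F :|: E) == C))
    && ((F :|: E) :\: E == F)
  = (F \in ecrsfs (A :|: W)) && (pos_cycles_of w W F == set0).
Proof.
have disC := vertex_disjointS C_cycles (ecrsf_vertex_disjoint ecF0).
rewrite !inE; apply/andP/andP => [[/andP[ecFE /eqP posFE] /eqP def_F] | [ecF /eqP posF]].
  have C_FE : C \subset cycles (F :|: E) by rewrite -posFE subsetIl.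
  have disFE := ecrsf_vertex_disjoint ecFE.
  rewrite -[F]def_F (ecrsf_remove C_FE ecFE); split=> //.
  rewrite /pos_cycles_of (cycles_remove C_FE disFE) setIDAC -/(pos_cycles_of _ _ _).
  by rewrite posFE setDv.
have avoidC c x : c \in C -> x \in cverts c -> x \notin W.
  by move/(subsetP C_cycles); apply: ecrsf_cycle_avoids.
rewrite (ecrsf_restore C_cycles disC avoidC ecF) /=.
rewrite /pos_cycles_of (cycles_restore C_cycles disC ecF) setIUl.
rewrite -/(pos_cycles_of _ _ _) posF setU0 (setIidPl C_pos) eqxx; split=> //.
rewrite setDUl setDv setU0; apply/eqP/setDidPl; exact: restore_disjoint ecF.
Qed.

(** The conditioned partition sum, up to a constant that depends only on
    [C]; the event is arbitrary, so that the normalisation of the conditional law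
    is the case of the full set. *)
Lemma sum_weight_conditioned B :
  \sum_(F in [set F | F :\: E \in B] :&: [set F | pos_cycles_of w W F == C]
         | F \in ecrsfs W) weight w F
  = (\prod_(c in C) \sum_(g in c) w g)
    * \sum_(F in B | F \in ecrsfs (A :|: W)) weight (wminus w W) F.
Proof.
rewrite (reindex_onto (fun F => F :|: E) (fun F => F :\: E)) /=; last first.
  move=> F /andP[]; rewrite in_setI => /andP[_]; rewrite in_set => /eqP posF _.
  have sEF : E \subset F by apply: all_edges_sub; rewrite -posF subsetIl.
  by rewrite setUC -[X in X :|: _](setIidPr sEF) setID.
rewrite mulr_sumr; under [RHS]eq_bigr do rewrite weight_wminus.
rewrite [RHS](bigID (fun F => pos_cycles_of w W F == set0)) /= [X in _ + X]big1 ?addr0.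
  rewrite [RHS](eq_bigr (fun F => weight w (F :|: E))) => [|F]; last first.
    by case/andP=> /andP[_]; rewrite in_set => ecF ->; rewrite weight_restore.
  apply: eq_bigl => F; rewrite -[RHS]andbA -restore_admissible in_setI !in_set.
  case: ((F :|: E) :\: E =P F) => [->|_]; rewrite ?andbT ?andbF //.
  by rewrite -andbA [X in _ && X]andbC.
by move=> F /andP[_ /negPf->]; rewrite mulr0.
Qed.

End Weights.

Theorem theorem5p1p2 (R : realFieldType) (G : graph)
    (G_connected : connected_graph G)
    (W : {set vertex G}) (w : {set dart G} -> R)
    (w_ge0 : forall g : {set dart G}, is_ocycle g -> 0 <= w g)
    (Z_gt0 : 0 < partition_fun w W)
    (C : {set {set {set dart G}}})
    (C_pos : C \subset pos_cycles w W)
    (C_gt0 : 0 < Pr (mu w W) [set F | pos_cycles_of w W F == C]) :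
  let A := extremities (all_edges C) in
  forall B : {set {set edge G}},
    condPr (mu w W) [set F | F :\: all_edges C \in B]
      [set F | pos_cycles_of w W F == C]
    = Pr (mu (wminus w W) (A :|: W)) B.
Proof.
move=> A B; set D := [set F | pos_cycles_of w W F == C] in C_gt0 *.
(* The conditioning event has positive probability, so some ECRSF contains
   all of [C]; this makes the cycles in [C] vertex-disjoint and disjoint from
   [W]. *)
have [F0 ecF0 C_F0] : exists2 F0, ecrsf W F0 & C \subset cycles F0.
  case: (pickP [pred F | (F \in D) && (F \in ecrsfs W)]) => [F0 | none].
    by rewrite /= !inE => /andP[/eqP <- ecF0]; exists F0 => //; apply: subsetIl.
  by rewrite Pr_mu big_pred0 ?mul0r ?ltxx in C_gt0.
have num := sum_weight_conditioned ecF0 C_F0 C_pos B.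
have := sum_weight_conditioned ecF0 C_F0 C_pos setT.
have -> : [set F | F :\: all_edges C \in [set: {set edge G}]] :&: D = D.
  by apply/setP=> F; rewrite !inE.
rewrite -/D -/A in num *; rewrite [X in _ = _ * X](_ : _ = partition_fun (wminus w W) (A :|: W)).
  move=> den; rewrite Pr_mu den in C_gt0; rewrite /condPr !Pr_mu num den.
  set k := \prod_(c in C) _ in C_gt0 *; set Zm := partition_fun _ (A :|: W) in C_gt0 *.
  (* This quantity is the probability of the conditioning event, so none of
     its three factors vanishes. *)
  have : k * Zm / partition_fun w W != 0 by rewrite gt_eqF.
  rewrite !mulf_eq0 invr_eq0 !negb_or => /andP[/andP[k0 Zm0] Z0].
  by field; rewrite k0 Zm0 Z0.
by apply: eq_bigl => F; rewrite in_setT.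
Qed.
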